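(* Let $G$ be a subgroup of Thompson's group $V$ and suppose that $G$ is swap-primitive. Then $G=V$.
   Context: $\mathfrak{C}$ is the Cantor space of infinite words over $\{0,1\}$ and $\Omega$ is the set of all finite words over $\{0,1\}$ (including the empty word), called addresses. For $\alpha\in\Omega$ the cone is $\alpha\mathfrak{C}=\{\alpha w\mid w\in\mathfrak{C}\}$. Addresses $\alpha,\beta$ are incomparable if $\alpha\mathfrak{C}\cap\beta\mathfrak{C}=\varnothing$. Thompson's group $V$ is the group (under composition) of all maps $\mathfrak{C}\to\mathfrak{C}$ for which there are two partitions $\alpha_1\mathfrak{C},\dots,\alpha_n\mathfrak{C}$ and $\beta_1\mathfrak{C},\dots,\beta_n\mathfrak{C}$ of $\mathfrak{C}$ into disjoint cones such that $\alpha_iw\mapsto\beta_iw$ for all $i$ and all $w\in\mathfrak{C}$. For incomparable addresses $\alpha,\beta$, the transposition $(\alpha\;\;\beta)\in V$ maps $\alpha w\mapsto\beta w$ and $\beta w\mapsto\alpha w$ for $w\in\mathfrak{C}$ and fixes all other points of $\mathfrak{C}$. It is a small transposition if $\alpha\mathfrak{C}\cup\beta\mathfrak{C}\neq\mathfrak{C}$. A subgroup $G\le V$ is swap-primitive if for any pair of non-empty addresses $\gamma,\delta\in\Omega$ there is a finite sequence of addresses $(\gamma_0,\gamma_1,\dots,\gamma_n)$ with $\gamma_0=\gamma$, $\gamma_n=\delta$ and such that, for each $0\le i\le n-1$, $(\gamma_i\;\;\gamma_{i+1})$ is a small transposition that belongs to $G$. *)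

(* Defs.v *)
From mathcomp Require Import all_boot.
From mathcomp Require Import mathcomp_extra boolp classical_sets.
Set Implicit Arguments.
Unset Strict Implicit.
Unset Printing Implicit Defensive.
Local Open Scope classical_set_scope.

(* No topology is needed, so points are bare sequences of letters
   (false = 0, true = 1). *)
Definition cantor : Type := nat -> bool.

Definition address : Type := seq bool.

Definition wcat (a : address) (w : cantor) : cantor :=
  fun n => if n < size a then nth false a n else w (n - size a).

Definition cone (a : address) : set cantor := range (wcat a).

Definition incomparable (a b : address) : Prop := cone a `&` cone b = set0.

(* The only constraint on n comes from the partitions (hence 0 < n). *)
Definition thompsonV : set (cantor -> cantor) :=
  [set f | exists (n : nat) (a b : 'I_n -> address),
    [/\ partition [set: 'I_n] (fun i => cone (a i)) [set: cantor],
        partition [set: 'I_n] (fun i => cone (b i)) [set: cantor]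
      & forall i w, f (wcat (a i) w) = wcat (b i) w]].

Definition subgroupV (G : set (cantor -> cantor)) : Prop :=
  [/\ G `<=` thompsonV,
      G id,
      (forall f g, G f -> G g -> G (f \o g))
    & (forall f, G f -> exists2 g, G g & cancel f g /\ cancel g f)].

Definition wprefix (a : address) (w : cantor) : bool := mkseq w (size a) == a.

Definition wdrop (n : nat) (w : cantor) : cantor := fun m => w (n + m).

(* Meaningful for incomparable a and b only; see the three lemmas below. *)
Definition transposition (a b : address) : cantor -> cantor := fun w =>
  if wprefix a w then wcat b (wdrop (size a) w)
  else if wprefix b w then wcat a (wdrop (size b) w)
  else w.

Definition small_transposition (a b : address) : Prop :=
  incomparable a b /\ cone a `|` cone b <> [set: cantor].

Definition swap_primitive (G : set (cantor -> cantor)) : Prop :=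
  forall c d : address, c <> [::] -> d <> [::] ->
    exists (n : nat) (s : nat -> address),
      [/\ s 0 = c, s n = d
        & forall i, i < n ->
            small_transposition (s i) (s i.+1) /\
            G (transposition (s i) (s i.+1))].

Lemma wdropK a w : wdrop (size a) (wcat a w) = w.
Proof.
by apply/funext => m; rewrite /wdrop /wcat ltnNge leq_addr /= addKn.
Qed.

Lemma wprefixP a w : reflect (cone a w) (wprefix a w).
Proof.
apply: (iffP eqP) => [aw|[v _ <-]].
  exists (wdrop (size a) w) => //; apply/funext => n; rewrite /wcat /wdrop.
  case: ltnP => [na|an]; last by rewrite subnKC.
  by rewrite -[in LHS]aw nth_mkseq.
apply: (@eq_from_nth _ false); rewrite size_mkseq // => i ia.
by rewrite nth_mkseq // /wcat ia.
Qed.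

Lemma transpositionl a b w : transposition a b (wcat a w) = wcat b w.
Proof.
rewrite /transposition; case: wprefixP => [_|]; first by rewrite wdropK.
by case; exists w.
Qed.

Lemma transpositionr a b w :
  incomparable a b -> transposition a b (wcat b w) = wcat a w.
Proof.
move=> ab; rewrite /transposition; case: wprefixP => [aw|_].
  have : (cone a `&` cone b) (wcat b w) by split=> //; exists w.
  by rewrite ab.
case: wprefixP => [_|]; first by rewrite wdropK.
by case; exists w.
Qed.

Lemma transposition_out a b w :
  ~ (cone a `|` cone b) w -> transposition a b w = w.
Proof.
move=> nw; rewrite /transposition; case: wprefixP => [aw|_].
  by case: nw; left.
by case: wprefixP => [bw|//]; case: nw; right.
Qed.

(* Main.v *)
(** Call two addresses adjacent when their transposition lies in [G].  Adjacency
    is preserved by conjugation, so if [a] is adjacent to [b] and to [c], and [b],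
    [c] are incomparable, then [b] and [c] are adjacent.  A path of small
    transpositions from [c] to [d] gives an element of [G] with [c w] sent to
    [d w], so adjacency of [g r] and [g s] does not depend on the nonempty address
    [g]; write then [inner r s].

    A path leaving the cone of a letter [e] shows that every [e x] is adjacent to
    some [~~ e u].  Conjugating these edges by one of the form [e -- ~~ e b], with
    [b] nonempty, gives [inner t (b u)] for every [t] incomparable to [b] and some
    [u].  From this, every nonempty address has an inner neighbour: otherwise all
    such [b] are powers of one letter [c], and an infinite descent on the least
    [m] such that [c^m] has an inner neighbour contradicts connectedness.
    Consequently two nonempty addresses [x], [y] for which [~~ e x] and [~~ e y]
    have a common neighbour in the cone of [e] have the same neighbours there, so
    that the component of [0] under small transpositions is a complete graph; by
    connectedness, [G] contains all transpositions.

    Finally, an element of [V] given by a pair of trees is a product of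
    transpositions, by induction on the number of leaves: permuting the leaves of
    the target tree, two sibling leaves of the source are sent to two sibling
    leaves in the right order, and both carets can be removed. *)
Require Import Defs.
From mathcomp Require Import all_boot.
From mathcomp Require Import mathcomp_extra boolp classical_sets.

Set Implicit Arguments.
Unset Strict Implicit.
Unset Printing Implicit Defensive.

Local Open Scope classical_set_scope.

(** * Addresses *)

Definition perp (a b : address) : bool := ~~ prefix a b && ~~ prefix b a.

Lemma perpC a b : perp a b = perp b a.
Proof. by rewrite /perp andbC. Qed.

Lemma perpxx a : perp a a = false.
Proof. by rewrite /perp prefix_refl. Qed.

Lemma perp_prefixl a x : perp a (a ++ x) = false.
Proof. by rewrite /perp prefix_prefix. Qed.

Lemma perp0s a : perp [::] a = false.
Proof. by rewrite /perp prefix0s. Qed.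

Lemma perps0 a : perp a [::] = false.
Proof. by rewrite perpC perp0s. Qed.

Lemma perp_cons x y a b : perp (x :: a) (y :: b) = (x != y) || perp a b.
Proof. by rewrite /perp !prefix_cons (eq_sym y); case: (x == y). Qed.

Lemma perp_neg e a b : perp (e :: a) (~~ e :: b).
Proof. by rewrite perp_cons; case: e. Qed.

Lemma perp_negl e a b : perp (~~ e :: a) (e :: b).
Proof. by rewrite perpC perp_neg. Qed.

Lemma perp_cat2l g a b : perp (g ++ a) (g ++ b) = perp a b.
Proof. by elim: g => //= x g IHg; rewrite perp_cons eqxx. Qed.

Lemma perp_catl a x b : perp a b -> perp (a ++ x) b.
Proof.
move=> /andP[ab ba]; apply/andP; split; first by apply: contraNN ab => /catl_prefix.
elim: a b ab ba => [|y a IHa] [|z b] //=.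
by case: (eqVneq y z) => //= _; apply: IHa.
Qed.

Lemma perp_neq0 a b : perp a b -> a != [::].
Proof. by case: a; rewrite ?perp0s. Qed.

Lemma comparableP a b :
  [\/ exists x, b = a ++ x, exists2 x, x != [::] & a = b ++ x | perp a b].
Proof.
have [/prefixP|ab] := boolP (prefix a b); first by constructor 1.
have [/prefixP[x aE]|ba] := boolP (prefix b a).
  constructor 2; exists x => //; apply: contraNneq ab => x0.
  by rewrite aE x0 cats0 prefix_refl.
by constructor 3; apply/andP.
Qed.

Lemma not_all_split (c : bool) x : ~~ all (pred1 c) x ->
  exists i s, x = nseq i c ++ ~~ c :: s.
Proof.
elim: x => //= y x IHx; case: (eqVneq y c) => [-> /= /IHx|yc _].
  by move=> [i [s ->]]; exists i.+1, s.
by exists 0, x; congr (_ :: _); case: y yc; case: (c).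
Qed.

Lemma nseq_catl (c : bool) n x y : nseq n c = x ++ y -> x = nseq (size x) c.
Proof.
move=> /(congr1 (all (pred1 c))); rewrite all_cat all_pred1_nseq.
by move=> /esym/andP[/all_pred1P].
Qed.

Lemma wcat_cat a b w : wcat (a ++ b) w = wcat a (wcat b w).
Proof.
apply/funext => n; rewrite /wcat size_cat nth_cat.
by case: (ltnP n (size a)) => na; [rewrite ltn_addr|rewrite ltn_subLR// subnDA].
Qed.

Lemma wcat_nil w : wcat [::] w = w.
Proof. by apply/funext => n; rewrite /wcat subn0. Qed.

Lemma wcat_consE x a w n :
  wcat (x :: a) w n = if n is m.+1 then wcat a w m else x.
Proof. by case: n. Qed.

Lemma wcat_cons_inj x y a b v w :
  wcat (x :: a) v = wcat (y :: b) w -> x = y /\ wcat a v = wcat b w.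
Proof.
move=> e; split; first by have := congr1 (@^~ 0) e.
by apply/funext => n; have := congr1 (@^~ n.+1) e.
Qed.

Lemma wcat_perp a b v w : perp a b -> wcat a v <> wcat b w.
Proof.
elim: a b => [|x a IHa] [|y b] //; rewrite perp_cons.
by move=> xy /wcat_cons_inj[xE]; apply: IHa; rewrite xE eqxx in xy.
Qed.

Lemma wcatE1 w : w = wcat [:: w 0] (wdrop 1 w).
Proof. by apply/funext => -[|n]; rewrite ?wcat_consE ?wcat_nil. Qed.

Lemma wcatE2 w : w = wcat [:: w 0; w 1] (wdrop 2 w).
Proof. by apply/funext => -[|[|n]]; rewrite ?wcat_consE ?wcat_nil. Qed.

Lemma incomparableP a b : incomparable a b <-> perp a b.
Proof.
split=> [ab0|ab]; last first.
  by apply/seteqP; split=> // _ [[v _ <-] [w _]] /esym; apply: wcat_perp.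
case: (comparableP a b) => // -[x]; [move=> xE|move=> _ xE]; exfalso.
- have : (cone a `&` cone b) (wcat b xpred0).
    by split; [rewrite xE wcat_cat; exists (wcat x xpred0)|exists xpred0].
  by rewrite ab0.
- have : (cone a `&` cone b) (wcat a xpred0).
    by split; [exists xpred0|rewrite xE wcat_cat; exists (wcat x xpred0)].
  by rewrite ab0.
Qed.

Lemma transposition_perp a b c w : perp a c -> perp b c ->
  transposition a b (wcat c w) = wcat c w.
Proof.
by move=> ac bc; apply: transposition_out => -[] [v _]; apply: wcat_perp.
Qed.

(** * Transpositions in a swap-primitive group *)

Section Group.
Variable G : set (cantor -> cantor).
Hypothesis subG : subgroupV G.
Hypothesis swapG : swap_primitive G.

Let G_id : G id. Proof. by case: subG. Qed.

Let G_comp f g : G f -> G g -> G (f \o g).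
Proof. by case: subG => _ _ Gc _; apply: Gc. Qed.

Definition tr a b := perp a b /\ G (transposition a b).

(** Conjugation by [f] carries the transposition of [a] and [b] to that of [a'] and [b'];
    injectivity of [f] keeps the cones disjoint. *)
Lemma tr_conj f a b a' b' : G f ->
  (forall w, f (wcat a w) = wcat a' w) -> (forall w, f (wcat b w) = wcat b' w) ->
  tr a b -> tr a' b'.
Proof.
move=> Gf fa fb [ab Gab]; case: subG => _ _ _ /(_ f Gf)[g Gg [fK gK]].
have ab' : perp a' b'.
  apply/incomparableP/seteqP; split=> // _ [[v _ <-] [w _]].
  rewrite -fa -fb => /(can_inj fK)/esym; exact: wcat_perp.
split=> //; suff -> : transposition a' b' = f \o transposition a b \o g.
  by do 2 apply: G_comp.
apply/funext => w /=.
have [[v _ <-]|na] := pselect (cone a' w).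
  by rewrite transpositionl -fa fK transpositionl fb.
have [[v _ <-]|nb] := pselect (cone b' w).
  rewrite transpositionr; last exact/incomparableP.
  by rewrite -fb fK transpositionr ?fa//; exact/incomparableP.
rewrite !transposition_out ?gK//; last by case.
by case=> -[v _ vE]; [apply: na|apply: nb]; exists v; rewrite // -1?fa -1?fb vE gK.
Qed.

Lemma tr_sym a b : tr a b -> tr b a.
Proof.
move=> ab; apply: (tr_conj (f := transposition a b)) (ab) => [|w|w].
- by case: ab.
- by rewrite transpositionl.
- by rewrite transpositionr//; apply/incomparableP; case: ab.
Qed.

(** Conjugate by the transposition of [a] and [b], which fixes the cone of [c] pointwise. *)
Lemma tr_move a b x c :
  tr a b -> tr (a ++ x) c -> perp a c -> perp b c -> tr (b ++ x) c.
Proof.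
move=> [ab Gab] axc ac bc; apply: tr_conj Gab _ _ axc => w.
  by rewrite !wcat_cat transpositionl.
by rewrite transposition_perp.
Qed.

Lemma tr_trans a b c : tr a b -> tr a c -> perp b c -> tr b c.
Proof.
by move=> ab ac bc; rewrite -[b]cats0; apply: (tr_move ab); rewrite ?cats0//; case: ac.
Qed.

Lemma tr_swap a b x y : tr a b -> tr (a ++ x) (b ++ y) -> tr (b ++ x) (a ++ y).
Proof.
move=> [ab Gab]; apply: tr_conj Gab _ _ => w; rewrite !wcat_cat.
  by rewrite transpositionl.
by rewrite transpositionr//; apply/incomparableP.
Qed.

(** * Paths of small transpositions *)

Lemma small_size a b : small_transposition a b -> perp a b /\ 2 < size a + size b.
Proof.
move=> [/incomparableP ab nT]; split=> //; rewrite ltnNge; apply/negP => s2.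
apply: nT; apply/seteqP; split=> // w _.
case: a b ab s2 => [|x [|? ?]] [|y [|? ?]] //=; rewrite ?addnS//.
rewrite perp_cons perpxx orbF => xy _.
rewrite [w]wcatE1; case: (eqVneq (w 0) x) => [->|wx]; [left|right];
  exists (wdrop 1 w) => //.
by congr wcat; congr (_ :: _); case: (w 0) x y wx xy => -[] [].
Qed.

(** Swap-primitivity as an induction principle along paths, with smallness expressed as a length
    bound. *)
Lemma connected_closed (M : address -> Prop) c : c <> [::] -> M c ->
  (forall a b, M a -> tr a b -> 2 < size a + size b -> M b) ->
  forall d, d <> [::] -> M d.
Proof.
move=> c0 Mc closed d d0; have [n [s [s0 <- step]]] := swapG c0 d0.
have : forall i, i <= n -> M (s i).
  elim=> [|i IHi] le; first by rewrite s0.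
  have [/small_size[pi si] Gi] := step _ le.
  exact: closed (IHi (ltnW le)) (conj pi Gi) si.
exact.
Qed.

Lemma rigid_transitive c d : c <> [::] -> d <> [::] ->
  exists2 f, G f & forall w, f (wcat c w) = wcat d w.
Proof.
move=> c0; move: d; apply: (connected_closed c0); first by exists id.
move=> a b [f Gf fE] [ab Gab] _; exists (transposition a b \o f); first exact: G_comp.
by move=> w /=; rewrite fE transpositionl.
Qed.

Lemma tr_shift c d r s : c <> [::] -> d <> [::] ->
  tr (c ++ r) (c ++ s) -> tr (d ++ r) (d ++ s).
Proof.
move=> c0 d0; have [f Gf fE] := rigid_transitive c0 d0.
by apply: tr_conj Gf _ _ => w; rewrite !wcat_cat fE.
Qed.

(* By [tr_shift] the choice of the letter [true] here is irrelevant. *)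
Definition inner r s := tr (true :: r) (true :: s).

Lemma inner_shift c r s : c <> [::] -> tr (c ++ r) (c ++ s) -> inner r s.
Proof. by move=> c0; apply: (@tr_shift c [:: true]). Qed.

Lemma inner_tr e r s : inner r s -> tr (e :: r) (e :: s).
Proof. exact: (@tr_shift [:: true] [:: e]). Qed.

Lemma tr_inner e r s : tr (e :: r) (e :: s) -> inner r s.
Proof. exact: (@inner_shift [:: e]). Qed.

Lemma inner_cat c r s : inner r s -> inner (c ++ r) (c ++ s).
Proof. exact: (@tr_shift [:: true] (true :: c)). Qed.

Lemma inner_strip c r s : inner (c ++ r) (c ++ s) -> inner r s.
Proof. exact: (@inner_shift (true :: c)). Qed.

Lemma inner_sym r s : inner r s -> inner s r. Proof. exact: tr_sym. Qed.

Lemma inner_perp r s : inner r s -> perp r s.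
Proof. by case; rewrite perp_cons eqxx. Qed.

Lemma inner_trans r s t : inner r s -> inner r t -> perp s t -> inner s t.
Proof. by move=> rs rt st; apply: tr_trans rs rt _; rewrite perp_cons st orbT. Qed.

Lemma inner_move r s x t :
  inner r s -> inner (r ++ x) t -> perp r t -> perp s t -> inner (s ++ x) t.
Proof.
move=> rs rxt rt st; apply: (@tr_move (true :: r) (true :: s)) => //;
  by rewrite ?perp_cons ?rt ?st ?orbT.
Qed.

Lemma inner_swap r s x y :
  inner r s -> inner (r ++ x) (s ++ y) -> inner (s ++ x) (r ++ y).
Proof. exact: tr_swap. Qed.

Lemma tr_inner_cross e u x y :
  tr (e :: u) (~~ e :: x) -> tr (e :: u) (~~ e :: y) -> perp x y -> inner x y.
Proof.
move=> ux uy xy; apply: (@tr_inner (~~ e)); apply: tr_trans ux uy _.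
by rewrite perp_cons xy orbT.
Qed.

Lemma tr_cross_inner e u x y :
  tr (e :: u) (~~ e :: x) -> inner x y -> tr (e :: u) (~~ e :: y).
Proof.
move=> ux /(inner_tr (~~ e)) xy; apply: tr_sym; apply: tr_trans xy (tr_sym ux) _.
exact: perp_negl.
Qed.

(* Follow a path from [e :: x] until it first leaves the cone of [e]; the point
   reached is then adjacent to all previous ones. *)
Lemma cross e x : exists2 u, tr (e :: x) (~~ e :: u) & 0 < size x + size u.
Proof.
pose M a := forall x, a = e :: x ->
  exists2 u, tr (e :: x) (~~ e :: u) & 0 < size x + size u.
suff : M (e :: x) by apply.
(* The path is run backwards, from [[:: ~~ e]], where [M] holds vacuously. *)
apply: (@connected_closed _ [:: ~~ e]) => //; first by move=> y []; case: (e).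
move=> [|z a] [|z' b] Ma ab ab2 {}x // [z'E bE]; subst z' b.
  by case: ab.
have [zE|ze] := eqVneq z e; last first.
  have zE : z = ~~ e by case: (z) (e) ze => -[].
  rewrite zE in ab; exists a; first exact: tr_sym.
  by move: ab2; rewrite /= !addSn addnS !ltnS addnC.
subst z; have [u au _] := Ma a erefl.
exists u; first by apply: tr_trans ab au _; exact: perp_neg.
case: ab; rewrite perp_cons eqxx perpC => /perp_neq0.
by case: (x).
Qed.

(** * Existence of inner neighbours *)

Lemma cross_nil e : exists2 b, tr [:: e] (~~ e :: b) & b != [::].
Proof. by have [[|x b] eb] := cross e [::] => //; exists (x :: b). Qed.

Lemma transfer e b t : tr [:: e] (~~ e :: b) -> perp t b -> exists u, inner t (b ++ u).
Proof.
move=> eb tb; have [u tu _] := cross (~~ e) t; rewrite negbK in tu.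
exists u; apply: inner_sym; apply: (@tr_inner (~~ e)).
apply: (@tr_move [:: e] (~~ e :: b)) => //; first exact: tr_sym.
- exact: perp_neg.
- by rewrite perp_cons perpC tb orbT.
Qed.

(** Write [b] as [b1 ++ c :: b2]. Since [b1 ++ ~~ c :: t] branches off [b] at this letter,
    [transfer] applies to it, and [b1] can be stripped. *)
Lemma transfer_letter e b c : tr [:: e] (~~ e :: b) -> c \in b ->
  forall t, exists u, inner (~~ c :: t) u.
Proof.
move=> eb /path.splitPr cb t; case: cb eb => b1 b2 eb.
have [|u] := transfer (t := b1 ++ ~~ c :: t) eb.
  by rewrite perp_cat2l perp_negl.
by rewrite -catA => /inner_strip; exists (c :: b2 ++ u).
Qed.

(* The hypothesis [powc] is refuted below: it contradicts connectedness. *)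
Section AllPowers.
Variable c : bool.
Hypothesis powc : forall e b, tr [:: e] (~~ e :: b) -> b = nseq (size b) c.

Let cross_nil_pow e : exists2 k, 0 < k & tr [:: e] (~~ e :: nseq k c).
Proof.
have [b eb b0] := cross_nil e; exists (size b); first by rewrite lt0n size_eq0.
by rewrite -(powc eb).
Qed.

(** Descent on the length of [x], compared with a [c^k] such that [e -- ~~e c^k]. If [x = c^k x'],
    conjugation by this edge replaces [x] by the shorter [x']; if [x] and [c^k] are incomparable, it
    gives [c^(k+j)] an inner neighbour. *)
Lemma nseq_isolated e j x :
  (forall m y, ~ inner (nseq m c) y) -> tr (e :: nseq j c) (~~ e :: x) ->
  x = nseq (size x) c.
Proof.
move=> noT; have [n] := ubnP (size x); elim: n e j x => // n IHn e j x.
rewrite ltnS => xn ex; have [k k0 ek] := cross_nil_pow e.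
case: (comparableP (nseq k c) x) => [[x' xE]|[y _ /nseq_catl//]|kx].
- rewrite xE in ex xn *; rewrite -cat_cons in ex.
  have := tr_swap (a := [:: e]) ek ex; rewrite cat_cons -nseqD -{2}[e]negbK => /IHn.
  rewrite size_cat size_nseq in xn * => -> //; first by rewrite size_nseq nseqD.
  by apply: leq_trans xn; rewrite -addn1 addnC leq_add2r.
- case: (noT (k + j) x); rewrite nseqD; apply: (@tr_inner (~~ e)); rewrite -cat_cons.
  apply: (tr_move ek ex); first exact: perp_neg.
  by rewrite perp_cons kx orbT.
Qed.

(** Otherwise, by [nseq_isolated], the addresses [e c^j] are closed under small edges, but they omit
    [[:: true; ~~ c]]. *)
Lemma some_nseq_inner : exists m y, inner (nseq m c) y.
Proof.
apply: contrapT => noT.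
have {}noT m y : ~ inner (nseq m c) y by move=> my; apply: noT; exists m, y.
have : exists e j, [:: true; ~~ c] = e :: nseq j c.
  apply: (@connected_closed (fun v => exists e j, v = e :: nseq j c) [:: true]) => //.
    by exists true, 0.
  move=> _ [|z x] [e [j ->]] ex _; first by case: ex.
  have [zE|ze] := eqVneq z e.
    by rewrite zE in ex; case: (noT j x); apply: tr_inner ex.
  have zE : z = ~~ e by case: (z) (e) ze => -[].
  rewrite zE in ex; exists z, (size x); congr (_ :: _).
  exact: nseq_isolated ex.
by move=> [e [[|j] [] //]]; case: (c).
Qed.

Lemma no_nseq_inner m x : ~ inner (nseq m c) x.
Proof.
have [n] := ubnP m; elim: n m x => // n IHn m x; rewrite ltnS => mn.
have {}IHn m' y : m' < m -> ~ inner (nseq m' c) y.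
  by move=> m'm; apply: IHn; exact: leq_trans mn.
(* If [y] began with [c], stripping a common power of [c] would lower the exponent. *)
have strip y : inner (nseq m c) y -> exists s, y = ~~ c :: s.
  move=> my; have /inner_perp := my; case: (boolP (all (pred1 c) y)) => [/all_pred1P ->|].
    have [sm|ms] := leqP (size y) m.
      by rewrite -(subnKC sm) nseqD perpC perp_prefixl.
    by rewrite -(subnKC (ltnW ms)) nseqD perp_prefixl.
  move=> /not_all_split[[|i] [s yE]]; first by exists s.
  rewrite yE in my * => p; exfalso.
  have [im|mi] := leqP i.+1 m.
    rewrite -(subnKC im) nseqD in my; apply: (IHn (m - i.+1)) (inner_strip my).
    by rewrite ltn_subrL /=; case: (m) im.
  by move: p; rewrite -(subnKC (ltnW mi)) nseqD -catA perp_prefixl.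
(* Conjugate [0 c^l c^(m-l) -- 0 ~~c s] by [1 -- 0 c^l]. *)
have step s : inner (nseq m c) (~~ c :: s) -> exists l, [/\ 0 < l, l < m &
    tr (false :: ~~ c :: s) (true :: nseq (m - l) c)].
  move=> ms; have [l l0 tl] := cross_nil_pow true; exists l.
  (* If [m <= l], padding [ms] by [c^(l-m)] makes [1] adjacent to [0 c^(l-m) ~~c s], against
     [powc]. *)
  have lm : l < m.
    rewrite ltnNge; apply/negP => ml.
    have := inner_cat (nseq (l - m) c) ms; rewrite -nseqD subnK// => ly.
    have := powc (tr_cross_inner tl ly) => /(congr1 (all (pred1 c))).
    by rewrite all_cat !all_pred1_nseq /=; case: (c).
  split=> //; apply: tr_sym; apply: (@tr_move (false :: nseq l c) [:: true]).
  - exact: tr_sym.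
  - by rewrite cat_cons -nseqD subnKC ?(ltnW lm)//; apply: inner_tr.
  - by rewrite perp_cons -(prednK l0) perp_neg.
  - by rewrite perp_cons.
have [k k0 tk] := cross_nil_pow false.
(* Then [0 ~~c s] is adjacent to both [1 c^(m-l)] and [1 ~~c t], so that
   [c^(m-l)] has an inner neighbour although [m - l < m]. *)
have neg s t : inner (nseq m c) (~~ c :: s) ->
    inner (~~ c :: t) (nseq k c ++ ~~ c :: s) -> False.
  move=> ms ts; have [l [l0 lm sl]] := step _ ms.
  apply: (IHn (m - l) (~~ c :: t)); first by rewrite ltn_subrL l0 (leq_trans _ lm).
  have st : tr (false :: ~~ c :: s) (true :: ~~ c :: t).
    apply: (@tr_move (true :: nseq k c) [:: false]).
    - exact: tr_sym.
    - exact: inner_sym.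
    - by rewrite perp_cons -(prednK k0) perp_neg.
    - by rewrite perp_cons.
  apply: tr_trans sl st _; rewrite perp_cons.
  by rewrite -(prednK (n := m - l)) ?subn_gt0// perp_neg.
(* It remains to compare [c^m] with [c^k u], an inner neighbour of [~~c s c^k]. *)
move=> mx; have [s xE] := strip _ mx; rewrite {x}xE in mx.
have [|u] := transfer (t := ~~ c :: s ++ nseq k c) tk.
  by rewrite -(prednK k0) perp_negl.
rewrite -cat_cons => su.
case: (comparableP (nseq m c) (nseq k c ++ u)) => [[y yE]|[y y0 yE]|mu].
(* Exchanging [c^m] and [~~c s] makes [c^(k+m)] adjacent to [~~c s y], while padding [mx] by [c^k]
   makes it adjacent to [c^k ~~c s]. *)
- rewrite yE in su; have := inner_swap (inner_sym mx) su.
  rewrite -nseqD addnC nseqD cat_cons => ky.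
  apply: (neg s (s ++ y)) => //; apply: inner_sym; apply: inner_trans ky _ => //.
    exact: inner_cat.
  by rewrite -(prednK k0) perp_neg.
- apply: (IHn (size (nseq k c ++ u)) (~~ c :: s ++ nseq k c)).
    by rewrite -[ltnRHS](size_nseq m c) yE [ltnRHS]size_cat -[ltnLHS]addn0;
      rewrite ltn_add2l lt0n size_eq0.
  by rewrite -(nseq_catl yE); apply: inner_sym.
(* Moving [~~c s] to [c^m] turns [su] into an edge between [c^k c^m] and [c^k u]; so [u] is again an
   inner neighbour of [c^m]. *)
- have := inner_move (inner_sym mx) su; rewrite -nseqD addnC nseqD.
  move=> /(_ _ _)/inner_strip-ku.
  have {}mu' : inner (nseq m c) u by apply: ku => //; rewrite -(prednK k0) perp_negl.
  have [s' uE] := strip _ mu'; rewrite uE in su mu'.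
  exact: neg mu' su.
Qed.

End AllPowers.

(** If [c :: x] had none, [transfer_letter] would exclude the letter [~~ c] from every [b], which is
    the refuted hypothesis [powc]. *)
Lemma every_inner x : x != [::] -> exists y, inner x y.
Proof.
case: x => // c x _; apply: contrapT => noT.
have powc e b : tr [:: e] (~~ e :: b) -> b = nseq (size b) c.
  move=> eb; apply/all_pred1P/allP => d db; apply: contrapT => /negP dc; apply: noT.
  have -> : c = ~~ d by case: (c) (d) dc => -[].
  exact: transfer_letter eb db x.
have [m [y my]] := some_nseq_inner powc.
exact: no_nseq_inner powc _ _ my.
Qed.

(** * Completeness of the adjacency graph *)

(** If [x] and [y] are comparable, pass through an inner neighbour of the shorter one, which is
    incomparable to both. *)
Lemma link e u u' x y : x != [::] -> y != [::] ->
  tr (e :: u) (~~ e :: x) -> tr (e :: u) (~~ e :: y) -> tr (e :: u') (~~ e :: x) ->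
  tr (e :: u') (~~ e :: y).
Proof.
move=> x0 y0 ux uy u'x.
case: (comparableP x y) => [[w yE]|[w _ xE]|xy].
- have [z xz] := every_inner x0; apply: tr_cross_inner (tr_cross_inner u'x xz) _.
  apply: tr_inner_cross (tr_cross_inner ux xz) uy _.
  by rewrite perpC yE perp_catl//; apply: inner_perp.
- have [z yz] := every_inner y0; apply: tr_cross_inner (inner_sym yz).
  apply: tr_cross_inner u'x _.
  apply: tr_inner_cross ux (tr_cross_inner uy yz) _.
  by rewrite xE perp_catl//; apply: inner_perp.
- exact: tr_cross_inner u'x (tr_inner_cross ux uy xy).
Qed.

Lemma tr_small a b : perp a b -> 2 < size a + size b -> tr a b.
Proof.
(* [M] is the component of [false]. *)
have [b0 tb0 b0_neq0] := cross_nil false.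
(* [[:: false]] and [true :: b0] serve as hubs. The edge from [[:: true]] to [[:: false]] is not
   small, so a non-empty [u] ties [[:: true]] to the second hub instead. *)
pose M a := match a with
  | false :: u => tr (false :: u) (true :: b0)
  | [:: true] => exists u, [/\ u != [::], tr (false :: u) [:: true] &
                              tr (false :: u) (true :: b0)]
  | true :: x => tr [:: false] (true :: x)
  | [::] => False
  end.
have allM : forall d, d <> [::] -> M d.
  apply: (@connected_closed _ [:: false]) => // -[|[] x] //= [|[] y] Mx xy xy2.
  - by case: xy.
  - case: x Mx xy xy2 => [|d x] Mx xy xy2.
      by case: xy; rewrite perp_cons perp0s.
    case: y xy xy2 => [|d' y] xy _; first by case: xy; rewrite perp_cons perps0.
    exact: tr_cross_inner Mx (tr_inner xy).
  - case: x Mx xy xy2 => [|d x] Mx xy xy2.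
      have [u [u0 tu ub]] := Mx; apply: tr_sym.
      have y0 : y != [::] by case: (y) xy2.
      exact: (@link true [::] b0 u y u0 y0 (tr_sym tu) xy (tr_sym ub)).
    exact: (@link false [::] y (d :: x) b0 isT b0_neq0 Mx tb0 (tr_sym xy)).
  - by case: xy.
  - case: y xy xy2 => [|d y] xy xy2.
      by exists x; split=> //; case: (x) xy2.
    exact: (@link false x [::] b0 (d :: y) b0_neq0 isT Mx xy tb0).
  - exact: tr_sym (tr_cross_inner (tr_sym Mx) (tr_inner xy)).
have Mtrue x : x != [::] -> tr [:: false] (true :: x).
  by case: x => // d x _; apply: (allM (true :: d :: x)).
have Tall r s : perp r s -> inner r s.
  move=> rs; apply: (@tr_inner_cross false [::]) => //; apply: Mtrue.
    exact: perp_neq0 rs.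
  by rewrite perpC in rs; apply: perp_neq0 rs.
have cross_all u x : 0 < size u + size x -> tr (false :: u) (true :: x).
  move=> ux; have [x0|x0] := eqVneq x [::]; last first.
    by apply: (@link false [::] u b0 x) => //; [exact: Mtrue|exact: (allM (false :: u))].
  rewrite {x}x0 addn0 lt0n size_eq0 in ux *.
  have [|v [v0 vt vb]] := allM [:: true]; first by [].
  apply: tr_sym; apply: (@link true b0 [::] v u) => //; apply: tr_sym => //.
  exact: (allM (false :: u)).
case: a b => [|[] x] [|[] y] //; rewrite ?perp0s ?perps0 ?perp_cons //= => xy.
- by move=> _; apply: inner_tr; apply: Tall.
- by rewrite addSn addnS !ltnS addnC => /cross_all/tr_sym.
- by rewrite addSn addnS !ltnS => /cross_all.
- by move=> _; apply: inner_tr; apply: Tall.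
Qed.

(** Only pairs of one-letter addresses escape [tr_small]; their transposition is the product of two
    small ones on the children. *)
Lemma G_transposition a b : perp a b -> G (transposition a b).
Proof.
move=> ab; have [/(tr_small ab)[]//|ab2] := ltnP 2 (size a + size b).
have Gx x y : x != y -> G (transposition [:: x] [:: y]).
  move=> xy; have txy z : tr [:: x; z] [:: y; z].
    by apply: tr_small => //; rewrite perp_cons xy.
  have -> : transposition [:: x] [:: y] =
      transposition [:: x; true] [:: y; true] \o
      transposition [:: x; false] [:: y; false].
    apply/funext => w; rewrite [w]wcatE2; move: (w 0) (w 1) (wdrop 2 w) => d d' v /=.
    have w2 z z' u : wcat [:: z; z'] u = wcat [:: z] (wcat [:: z'] u).
      exact: (wcat_cat [:: z]).
    have pp z z' t : perp [:: z; t] [:: z'; ~~ t].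
      by rewrite !perp_cons; case: t => /=; rewrite orbT.
    have [dx|dx] := eqVneq d x.
      rewrite dx [in LHS]w2 transpositionl -w2.
      case: d'; last by rewrite transpositionl transposition_perp// (pp _ _ true).
      by rewrite transposition_perp ?transpositionl// (pp _ _ false).
    have -> : d = y by case: (d) (x) (y) xy dx => -[] [].
    have xy1 : incomparable [:: x] [:: y] by apply/incomparableP; rewrite perp_cons xy.
    have xy2 z : incomparable [:: x; z] [:: y; z].
      by apply/incomparableP; rewrite perp_cons xy.
    rewrite [in LHS]w2 transpositionr// -w2.
    case: d'; last by rewrite transpositionr// transposition_perp// (pp _ _ true).
    by rewrite transposition_perp ?transpositionr// (pp _ _ false).
  by apply: G_comp; [case: (txy true)|case: (txy false)].
case: a b ab ab2 => [|x [|? ?]] [|y [|? ?]]; rewrite ?perp0s ?perps0//= ?addnS//.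
by rewrite perp_cons perpxx orbF => /Gx.
Qed.

End Group.

(** * Generation of V by transpositions *)

(** A complete prefix code, that is, the leaves of a finite binary tree, possibly with
    repetitions. *)
Definition code (l : seq address) : Prop :=
  {in l &, forall a b, a != b -> perp a b} /\
  forall w, exists2 a, a \in l & cone a w.

(** Take a longest address [g x] of [l]. A member of [l] covering a point below [g ~~x] is not
    longer, by maximality, and not a prefix of [g], which would be comparable to [g x]; so it is
    [g ~~x]. *)
Lemma code_sibling l : code l -> uniq l -> 1 < size l ->
  exists g, g ++ [:: false] \in l /\ g ++ [:: true] \in l.
Proof.
move=> [lperp lcov] lu l1.
have [a al amax] : exists2 a, a \in l & {in l, forall b, size b <= size a}.
  case: (l) l1 => // b s _; elim: s b => [|c s IHs] b.
    by exists b; rewrite ?mem_head// => c; rewrite inE => /eqP ->.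
  have [a ain amax] := IHs c.
  have [ab|ba] := leqP (size a) (size b).
    exists b; rewrite ?mem_head// => d; rewrite inE => /predU1P[->//|/amax da].
    exact: leq_trans da ab.
  exists a; first by rewrite inE ain orbT.
  by move=> d; rewrite inE => /predU1P[->|/amax//]; exact: ltnW.
have [c cl ca] : exists2 c, c \in l & c != a.
  case: (l) l1 lu => [|x [|y s]]//= _ /andP[]; rewrite inE negb_or => /andP[xy _] _.
  have [<-|xa] := eqVneq x a; last by exists x; rewrite ?mem_head.
  by exists y; rewrite 1?eq_sym// !inE eqxx orbT.
have := lperp _ _ cl al ca; case/lastP: a al amax {ca} => [|g x] al amax.
  by rewrite perps0.
move=> _; rewrite -cats1 in al amax.
have [d dl [v _ vE]] := lcov (wcat (g ++ [:: ~~ x]) xpred0).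
suff gl : g ++ [:: ~~ x] \in l by exists g; case: (x) al gl.
case: (comparableP d (g ++ [:: ~~ x])) => [[y gE]|[y y0 dE]|/wcat_perp/(_ vE)//].
- case/lastP: y gE => [|y z]; first by rewrite cats0 => ->.
  rewrite cats1 -rcons_cat => /rcons_inj[gE _].
  have : perp d (g ++ [:: x]).
    apply: lperp => //; apply/eqP => /(congr1 size)/eqP.
    by rewrite gE !size_cat -addnA -[eqbLHS]addn0 eqn_add2l addn1.
  by rewrite gE -catA perp_prefixl.
- have := amax d dl; rewrite dE !size_cat leqNgt -[ltnLHS]addn0 ltn_add2l.
  by rewrite lt0n size_eq0 y0.
Qed.

Lemma perp_siblings a g : perp a (g ++ [:: false]) -> perp a (g ++ [:: true]) -> perp a g.
Proof.
case: (comparableP a g) => [[x ->]|[x x0 ->]|//].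
  by rewrite -!catA perp_prefixl.
by case: x x0 => // -[] x _; rewrite !perp_cat2l !perp_cons eqxx perps0.
Qed.

(** Describing [l'] by membership lets the lemma serve both a list of leaves and its image under a
    map. *)
Lemma code_merge l l' g : code l ->
  g ++ [:: false] \in l -> g ++ [:: true] \in l ->
  (forall a, (a \in l') =
    (a == g) || [&& a \in l, a != g ++ [:: false] & a != g ++ [:: true]]) ->
  code l'.
Proof.
move=> [lperp lcov] g0 g1 l'E.
have pg a : [&& a \in l, a != g ++ [:: false] & a != g ++ [:: true]] -> perp a g.
  by move=> /and3P[al a0 a1]; apply: perp_siblings; apply: lperp.
split=> [a b|w].
  rewrite !l'E => /predU1P[->|al] /predU1P[->|bl]; first by rewrite eqxx.
  - by move=> _; rewrite perpC pg.
  - by move=> _; rewrite pg.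
  - by case/and3P: al => al _ _; case/and3P: bl => bl _ _; apply: lperp.
have [a al [v _ <-]] := lcov w.
have [->|a0] := eqVneq a (g ++ [:: false]).
  by rewrite wcat_cat; exists g; [rewrite l'E eqxx|exists (wcat [:: false] v)].
have [->|a1] := eqVneq a (g ++ [:: true]).
  by rewrite wcat_cat; exists g; [rewrite l'E eqxx|exists (wcat [:: true] v)].
by exists a; [rewrite l'E al a0 a1 orbT|exists v].
Qed.

Lemma code_notin l g x : code l -> g ++ [:: x] \in l -> g \notin l.
Proof.
move=> [lperp _] gl; apply/negP => gl'; have : perp g (g ++ [:: x]).
  apply: lperp => //; apply/eqP => /(congr1 size)/eqP.
  by rewrite size_cat addn1 eqn_leq ltnn andbF.
by rewrite perp_prefixl.
Qed.

Lemma code1 a : code [:: a] -> a = [::].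
Proof.
case: a => // x a [_ /(_ (fun=> ~~ x))[b]]; rewrite inE => /eqP -> [v _].
by move/(congr1 (@^~ 0)); rewrite /wcat /=; case: x.
Qed.

(** A tree pair for [f]: [h] matches the source leaves in [l] with the target leaves. *)
Definition replaces (l : seq address) (h : address -> address) (f : cantor -> cantor) :=
  [/\ code [seq h a | a <- l], {in l &, injective h} &
      {in l, forall a w, f (wcat a w) = wcat (h a) w}].

Section Generation.
Variable G : set (cantor -> cantor).
Hypothesis subG : subgroupV G.
Hypothesis transpG : forall a b, perp a b -> G (transposition a b).

(** Compose [f] with the transposition of [h a] and [y]. The last clause lets a second correction
    leave the first one in place. *)
Lemma replaces_swap l h f a y : code l -> replaces l h f ->
  a \in l -> y \in [seq h b | b <- l] ->
  exists h' f', [/\ replaces l h' f', G f' -> G f, h' a = y,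
    [seq h' b | b <- l] =i [seq h b | b <- l] &
    {in l, forall b, h b != h a -> h b != y -> h' b = h b}].
Proof.
move=> lcode [hcode hinj hf] al /mapP[c cl ->{y}].
have [ac|ac] := eqVneq (h a) (h c); first by exists h, f.
have hac : perp (h a) (h c) by apply: hcode.1 => //; exact: map_f.
pose h' b := if h b == h a then h c else if h b == h c then h a else h b.
have h'E : [seq h' b | b <- l] =i [seq h b | b <- l].
  move=> z; apply/mapP/mapP => -[b bl ->]; rewrite /h'.
    by case: eqP => _; [exists c|case: eqP => _; [exists a|exists b]].
  have [->|ba] := eqVneq (h b) (h a).
    by exists c => //; rewrite eqxx eq_sym (negPf ac).
  have [->|bc] := eqVneq (h b) (h c); first by exists a => //; rewrite eqxx.
  by exists b => //; rewrite (negPf ba) (negPf bc).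
exists h', (transposition (h a) (h c) \o f); split=> //.
- split.
  + case: hcode => p q; split=> [u v|w]; first by rewrite !h'E; apply: p.
    by have [u] := q w; exists u; rewrite ?h'E.
  + move=> u v ul vl; rewrite /h' => uv; apply: hinj => //; move: uv.
    case: (eqVneq (h u) (h a)) => [->|ua]; case: (eqVneq (h v) (h a)) => [->|va] //.
    * by case: eqP => [-> /esym//|vc /esym/vc].
    * by case: eqP => [->//|uc /uc].
    * case: (eqVneq (h u) (h c)) => [->|uc]; case: (eqVneq (h v) (h c)) => [->|vc] //.
      - by move/esym/eqP; rewrite (negPf va).
      - by move/eqP; rewrite (negPf ua).
  + move=> b bl w /=; rewrite hf // /h'.
    have [->|ba] := eqVneq (h b) (h a); first by rewrite transpositionl.
    have [->|bc] := eqVneq (h b) (h c).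
      by rewrite transpositionr//; apply/incomparableP.
    by rewrite transposition_perp//; apply: hcode.1; rewrite ?map_f// eq_sym.
- case: subG => _ _ Gc /(_ _ (transpG hac))[t Gt [tK _]] Gf.
  by have := Gc _ _ Gt Gf; congr G; apply/funext => w /=; rewrite tK.
- by rewrite /h' eqxx.
- by move=> b bl ba bc; rewrite /h' (negPf ba) (negPf bc).
Qed.

Lemma replaces_G l h f : uniq l -> code l -> replaces l h f -> G f.
Proof.
have [n] := ubnP (size l); elim: n l h f => // n IHn l h f.
rewrite ltnS => ln lu lcode lf.
have [l1|l1] := leqP (size l) 1.
  case: l l1 {ln lu} lcode lf => [|a [|? ?]] // _.
    by move=> [_ /(_ xpred0)[]].
  move=> /code1 -> [/code1 /= h0 _ hf].
  have -> : f = id.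
    by apply/funext => w; have := hf [::] (mem_head _ _) w; rewrite h0 !wcat_nil.
  by case: subG.
have [g [g0 g1]] := code_sibling lcode lu l1.
have [|||d [d0 d1]] := @code_sibling [seq h a | a <- l].
- by case: lf.
- by rewrite map_inj_in_uniq//; case: lf.
- by rewrite size_map.
have [h1 [f1 [lf1 Gf1 h1g h1E _]]] := replaces_swap lcode lf g0 d0.
have d1' : d ++ [:: true] \in [seq h1 a | a <- l] by rewrite h1E.
have [h2 [f2 [lf2 Gf2 h2g h2E h2h]]] := replaces_swap lcode lf1 g1 d1'.
have neq01 (b : address) : b ++ [:: false] != b ++ [:: true].
  by rewrite eqseq_cat// eqxx.
have h2g0 : h2 (g ++ [:: false]) = d ++ [:: false].
  rewrite -h1g; apply: h2h => //; last by rewrite h1g.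
  by case: lf1 => _ inj _; apply: contraNneq (neq01 g) => /inj ->.
apply: Gf1; apply: Gf2.
have [hcode hinj hf] := lf2.
have gl := code_notin lcode g0.
have dl : d \notin [seq h2 a | a <- l].
  by apply: (@code_notin _ d true) => //; rewrite -h2g map_f.
(* Remove both carets: [g] replaces its two children and is sent to [d]. *)
pose l0 := rem (g ++ [:: true]) (rem (g ++ [:: false]) l).
have l0E a : (a \in l0) = [&& a \in l, a != g ++ [:: false] & a != g ++ [:: true]].
  by rewrite /l0 mem_rem_uniq ?rem_uniq// inE mem_rem_uniq// inE andbC -andbA andbCA.
pose h3 a := if a == g then d else h2 a.
have h3l a : a \in l -> h3 a = h2 a.
  by move=> al; rewrite /h3; case: eqP => // aE; rewrite -aE al in gl.
have l0l a : a \in l0 -> a \in l by rewrite l0E => /and3P[].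
have h3g : h3 g = d by rewrite /h3 eqxx.
apply: (IHn (g :: l0) h3).
- rewrite /= /l0 !size_rem//; last by rewrite mem_rem_uniq// !inE eq_sym neq01.
  by case: (size l) l1 ln => [|[|m]].
- by rewrite /= !rem_uniq// andbT; apply: contraNN gl => /l0l.
- by apply: (code_merge lcode g0 g1) => a; rewrite inE l0E.
split.
- apply: (code_merge (g := d) hcode); first by rewrite -h2g0 map_f.
    by rewrite -h2g map_f.
  move=> z; rewrite inE h3g; congr (_ || _).
  apply/mapP/and3P => [[a al0 ->]|[/mapP[a al ->] a0 a1]].
    have al := l0l _ al0; rewrite h3l// map_f// -h2g0 -h2g.
    move: al0; rewrite l0E => /and3P[_ a0 a1].
    by split=> //; [apply: contraNneq a0|apply: contraNneq a1] => /hinj ->.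
  exists a; last by rewrite h3l.
  rewrite l0E al /=; apply/andP; split; first by apply: contraNneq a0 => ->; rewrite h2g0.
  by apply: contraNneq a1 => ->; rewrite h2g.
- move=> a b; rewrite !inE => /predU1P[->|/l0l al] /predU1P[->|/l0l bl] //.
  + by rewrite h3g h3l// => dE; rewrite dE map_f in dl.
  + by rewrite h3g h3l// => dE; rewrite -dE map_f in dl.
  + by rewrite !h3l//; apply: hinj.
- move=> a; rewrite inE => /predU1P[->|/l0l al] w; last by rewrite h3l// hf.
  rewrite h3g [w]wcatE1 -!wcat_cat.
  by case: (w 0); rewrite hf// ?h2g ?h2g0.
Qed.

Lemma thompsonV_sub : thompsonV `<=` G.
Proof.
move=> f [n [a [b [pa pb fab]]]].
(* Parts of a partition are non-empty, so equal cones force equal indices. *)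
have inj (c : 'I_n -> address) :
    partition [set: 'I_n] (fun i => cone (c i)) [set: cantor] -> injective c.
  move=> [_ tc ce] i j cij; apply: tc => //.
  by rewrite cij setIid; apply: ce.
have codeI (c : 'I_n -> address) :
    partition [set: 'I_n] (fun i => cone (c i)) [set: cantor] ->
    code [seq c i | i <- enum 'I_n].
  move=> pc; have [cov tc _] := pc; split.
    move=> _ _ /mapP[i _ ->] /mapP[j _ ->] cij; apply/incomparableP.
    by apply: contrapT => /eqP/set0P/(tc _ _ I I) ij; rewrite ij eqxx in cij.
  move=> w; have : [set: cantor] w by [].
  by rewrite -cov => -[i _ iw]; exists (c i) => //; rewrite map_f// mem_enum.
(* The default [[::]] arises only off the range of [a]. *)
pose h x := odflt [::] (omap b [pick i | a i == x]).
have ha i : h (a i) = b i.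
  by rewrite /h; case: pickP => [j /eqP/(inj _ pa) ->//|/(_ i)]; rewrite eqxx.
apply: (@replaces_G [seq a i | i <- enum 'I_n] h).
- by rewrite map_inj_uniq ?enum_uniq//; exact: inj.
- exact: codeI.
- split.
  + by rewrite -map_comp (eq_map (g := b)) //; exact: codeI.
  + by move=> _ _ /mapP[i _ ->] /mapP[j _ ->]; rewrite !ha => /(inj _ pb) ->.
  + by move=> _ /mapP[i _ ->] w; rewrite ha fab.
Qed.

End Generation.

Theorem theorem8p17 (G : set (cantor -> cantor)) :
  subgroupV G -> swap_primitive G -> G = thompsonV.
Proof.
move=> subG swapG; apply/seteqP; split; first by case: subG.
by apply: thompsonV_sub => // a b; apply: G_transposition.
Qed.
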